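(* Let $q\ge 3$ be a power of a prime $p$. The DGZ curve is $\mathbb{F}_{q^3}$-Frobenius non-classical.
   Context: Put $D_1(x,y,z)=\begin{vmatrix} x & x^q & x^{q^3}\\ y & y^q & y^{q^3}\\ z & z^q & z^{q^3}\end{vmatrix}$, $D_2(x,y,z)=\begin{vmatrix} x & x^q & x^{q^2}\\ y & y^q & y^{q^2}\\ z & z^q & z^{q^2}\end{vmatrix}$ and $F=D_1/D_2$, an absolutely irreducible homogeneous polynomial of degree $q^3-q^2$ over $\mathbb{F}_q$. The DGZ curve is the plane curve over $\overline{\mathbb{F}}_q$ with equation $F(x,y,z)=0$. A plane curve defined over $\mathbb{F}_{q^3}$ is $\mathbb{F}_{q^3}$-Frobenius non-classical if the tangent at any nonsingular point $P=(a:b:c)$ of the curve (over $\overline{\mathbb{F}}_q$) contains the point $P^{q^3}=(a^{q^3}:b^{q^3}:c^{q^3})$. *)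

(* Defs.v *)
From mathcomp Require Import all_boot all_fingroup all_algebra all_solvable all_field.
From mathcomp Require Import mpoly.

Set Implicit Arguments.
Unset Strict Implicit.
Unset Printing Implicit Defensive.

Import GRing.Theory.

Local Open Scope ring_scope.

Definition moore_det (R : comNzRingType) (q : nat) (e : seq nat)
    (x : 'I_3 -> R) : R :=
  \det (\matrix_(i < 3, j < 3) x i ^+ (q ^ nth 0%N e j)).

Definition D1 (R : comNzRingType) (q : nat) (x : 'I_3 -> R) : R :=
  moore_det q [:: 0; 1; 3]%N x.

Definition D2 (R : comNzRingType) (q : nat) (x : 'I_3 -> R) : R :=
  moore_det q [:: 0; 1; 2]%N x.

Definition vars (R : comNzRingType) : 'I_3 -> {mpoly R[3]} :=
  fun i => 'X_i.
Arguments vars : clear implicits.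

Lemma factor_all_roots (R : idomainType) (p : {poly R}) (rs : seq R) :
  uniq rs -> all (root p) rs ->
  exists s : {poly R}, p = s * \prod_(r <- rs) ('X - r%:P).
Proof.
elim: rs p => [|a rs IH] p; first by exists p; rewrite big_nil mulr1.
case/andP=> a_rs uniq_rs /= /andP [/factor_theorem [p' ->] roots].
have [|s ->] := IH p' uniq_rs.
  apply/allP => b b_rs; move/allP/(_ b b_rs): roots.
  rewrite rootM root_XsubC => /orP [//|/eqP eb].
  by rewrite -eb b_rs in a_rs.
by exists s; rewrite big_cons -mulrA [X in s * X]mulrC.
Qed.

Lemma all_roots_prod (R : idomainType) (p : {poly R}) (rs : seq R) :
  uniq rs -> all (root p) rs -> (size p <= (size rs).+1)%N ->
  p = p`_(size rs) *: \prod_(r <- rs) ('X - r%:P).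
Proof.
move=> u roots sp; have [s ps] := factor_all_roots u roots.
set P := \prod_(_ <- _) _ in ps *.
have mP : P \is monic by apply: monic_prod_XsubC.
have sP : size P = (size rs).+1 by rewrite size_prod_XsubC.
have [s0|s0] := eqVneq s 0; first by rewrite ps s0 mul0r coef0 scale0r.
have : (size s <= 1)%N.
  move: sp; rewrite ps size_Mmonic // sP addnS /=.
  by rewrite -add1n leq_add2r.
move/size1_polyC => sE.
have -> : p`_(size rs) = s`_0.
  rewrite ps sE mul_polyC coefZ coefC /=.
  by have := monicP mP; rewrite lead_coefE sP /= => ->; rewrite mulr1.
by rewrite ps {1}sE mul_polyC.
Qed.

(* [DGZ] needs D2 to divide D1.  Adjoining a row T, T^q, T^(q^2), T^(q^3) gives a
   polynomial in T of degree at most q^3, with T^(q^3)-coefficient - D2 and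
   T^(q^2)-coefficient D1, which vanishes at the q^3 linear forms over F. *)
Definition lin (F : finFieldType) (v : {ffun 'I_3 -> F}) : {mpoly F[3]} :=
  \sum_i v i *: 'X_i.

Lemma lin_inj (F : finFieldType) : injective (@lin F).
Proof.
have linE (w : {ffun 'I_3 -> F}) i : (lin w)@_U_(i) = w i.
  rewrite /lin raddf_sum /= (bigD1 i) //= mcoeffZ mcoeffX eqxx mulr1.
  rewrite big1 ?addr0 // => j ji; rewrite mcoeffZ mcoeffX.
  by rewrite eq_mnm1 (negPf ji) mulr0.
by move=> u v E; apply/ffunP => i; rewrite -!linE E.
Qed.

Lemma pchar_nat_card (F : finFieldType) k :
  [pchar {mpoly F[3]}].-nat (#|F| ^ k)%N.
Proof.
have [p p_pr pF] := finPcharP F.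
have pA : p \in [pchar {mpoly F[3]}].
  by rewrite inE p_pr /= -mpolyC_nat (pcharf0 pF) mpolyC0.
rewrite pnatX (eq_pnat _ (pcharf_eq pA)).
have /abelem_pgroup := fin_ring_pchar_abelem pF.
by rewrite /pgroup cardsT => ->.
Qed.

Lemma lin_exp (F : finFieldType) (v : {ffun 'I_3 -> F}) k :
  lin v ^+ (#|F| ^ k) = \sum_i v i *: ('X_i ^+ (#|F| ^ k)).
Proof.
have vk (a : F) : a ^+ (#|F| ^ k) = a.
  by elim: k => [|k IH]; rewrite ?expr1 // expnSr exprM IH expf_card.
rewrite /lin !big_ord_recl !big_ord0 !addr0.
by rewrite !exprDn_pchar ?pchar_nat_card // !exprZn !vk.
Qed.

Lemma D2_dvd_D1 (F : finFieldType) :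
  exists P : {mpoly F[3]}, P * D2 #|F| (vars F) == D1 #|F| (vars F).
Proof.
set q := #|F|; have q1 : (1 < q)%N by apply: finNzRing_gt1.
pose A := {mpoly F[3]}.
pose M : 'M[{poly A}]_4 := \matrix_(i, j)
  (if unlift 0 i is Some k then ('X_k ^+ (q ^ j))%:P else 'X^(q ^ j)).
pose c j : A := (-1) ^+ j * \det (\matrix_(i < 3, k < 3) ('X_i : A) ^+ (q ^ bump j k)).
have cE (j : 'I_4) : cofactor M 0 j = (c j)%:P.
  rewrite /cofactor /c add0n polyCM polyC_exp polyCN; congr (_ * _).
  rewrite -det_map_mx; congr (\det _); apply/matrixP => i k.
  by rewrite !mxE liftK.
have pE : \det M = \sum_(j < 4) c j *: 'X^(q ^ j).
  rewrite (expand_det_row _ 0); apply: eq_bigr => j _.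
  by rewrite cE mxE unlift_none mulrC mul_polyC.
have coefp (k : 'I_4) : (\det M)`_(q ^ k) = c k.
  rewrite pE coef_sum (bigD1 k) //= coefZ coefXn eqxx mulr1.
  rewrite big1 ?addr0 // => j jk.
  by rewrite coefZ coefXn eqn_exp2l // eq_sym val_eqE (negPf jk) mulr0.
pose rs := [seq lin v | v : {ffun 'I_3 -> F}].
have srs : size rs = (q ^ 3)%N by rewrite size_map -cardE card_ffun card_ord.
have urs : uniq rs by rewrite map_inj_uniq ?enum_uniq //; apply: lin_inj.
have root_rs : all (root (\det M)) rs.
  apply/allP => _ /mapP [v _ ->].
  rewrite /root -[_.[_]]/(horner_eval (lin v) (\det M)) -det_map_mx.
  apply/det0P.
  exists (\row_i (if unlift 0 i is Some k then (v k)%:MP else -1)).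
    apply/eqP => /rowP/(_ 0); rewrite !mxE unlift_none => /eqP.
    by rewrite oppr_eq0 oner_eq0.
  apply/rowP => j; rewrite !mxE big_ord_recl !mxE unlift_none.
  rewrite /= /horner_eval hornerXn lin_exp mulN1r.
  apply/eqP; rewrite addrC subr_eq0; apply/eqP; apply: eq_bigr => i _.
  by rewrite !mxE liftK hornerC mul_mpolyC.
have sM : (size (\det M) <= (size rs).+1)%N.
  rewrite pE srs; apply: (leq_trans (size_sum _ _ _)).
  apply/bigmax_leqP => j _; apply: (leq_trans (size_scale_leq _ _)).
  by rewrite size_polyXn ltnS leq_exp2l // -ltnS.
have := congr1 (fun P : {poly A} => P`_(q ^ 2)) (all_roots_prod urs root_rs sM).
set f := \prod_(_ <- _) _.
rewrite srs coefZ (coefp (Ordinal (isT : (2 < 4)%N))).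
rewrite (coefp (Ordinal (isT : (3 < 4)%N))) /c => E.
have d1 : D1 q (vars F) =
    \det (\matrix_(i < 3, k < 3) ('X_i : A) ^+ (q ^ bump 2 k)).
  congr (\det _); apply/matrixP => i k; rewrite !mxE.
  by case: k => -[|[|[|]]].
have d2 : D2 q (vars F) =
    \det (\matrix_(i < 3, k < 3) ('X_i : A) ^+ (q ^ bump 3 k)).
  congr (\det _); apply/matrixP => i k; rewrite !mxE.
  by case: k => -[|[|[|]]].
exists (- f`_(q ^ 2)); rewrite d1 d2.
move: E; rewrite sqrrN expr1n mul1r => ->.
by rewrite exprS sqrrN expr1n mulr1 mulN1r !mulNr mulrC.
Qed.

Lemma D2_neq0 (F : finFieldType) : D2 #|F| (vars F) != 0.
Proof.
set q := #|F|; have q1 : (1 < q)%N by apply: finNzRing_gt1.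
pose h : {rmorphism {mpoly F[3]} -> {poly F}} :=
  mmap polyC (fun i : 'I_3 => 'X^i).
suff : h (D2 q (vars F)) != 0 by apply: contra_neq => ->; rewrite rmorph0.
have -> : h (D2 q (vars F)) = \det (Vandermonde 3 (\row_(j < 3) 'X^(q ^ j))).
  rewrite -det_map_mx; congr (\det _); apply/matrixP => i j.
  rewrite !mxE rmorphXn /= mmapX mmap1U -!exprM mulnC.
  by case: j => -[|[|[|]]].
rewrite det_Vandermonde prodf_seq_neq0; apply/allP => i _ /=.
rewrite prodf_seq_neq0; apply/allP => j _; apply/implyP => ij.
rewrite !mxE subr_eq0; apply/negP => /eqP /(congr1 (fun P : {poly F} => size P)).
rewrite !size_polyXn => /eqP; rewrite eqSS eqn_exp2l // => /eqP ji.
by rewrite ji ltnn in ij.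
Qed.

(* The quotient D1 / D2 in F[x, y, z]; see [DGZ_D2] and [DGZ_unique]. *)
Definition DGZ (F : finFieldType) : {mpoly F[3]} := xchoose (D2_dvd_D1 F).

Lemma DGZ_D2 (F : finFieldType) :
  DGZ F * D2 #|F| (vars F) = D1 #|F| (vars F).
Proof. exact/eqP/(xchooseP (D2_dvd_D1 F)). Qed.

Lemma DGZ_unique (F : finFieldType) (P : {mpoly F[3]}) :
  P * D2 #|F| (vars F) = D1 #|F| (vars F) -> P = DGZ F.
Proof. by rewrite -DGZ_D2; apply: mulIf; apply: D2_neq0. Qed.

(* Points of the projective plane are given by homogeneous coordinates. *)
Definition on_curve (K : fieldType) (G : {mpoly K[3]}) (P : 'rV[K]_3) : bool :=
  (P != 0) && (G.@[P 0] == 0).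

Definition nonsingular_at (K : fieldType) (G : {mpoly K[3]})
    (P : 'rV[K]_3) : bool :=
  [exists i, (G^`M(i)).@[P 0] != 0].

Definition on_tangent (K : fieldType) (G : {mpoly K[3]})
    (P Q : 'rV[K]_3) : bool :=
  \sum_(i < 3) (G^`M(i)).@[P 0] * Q 0 i == 0.

(* For [N] a power of the characteristic: the coefficients of [G] lie in the
   subfield of [K] with [N] elements. *)
Definition defined_over (K : fieldType) (N : nat) (G : {mpoly K[3]}) : Prop :=
  forall m : 'X_{1..3}, G@_m ^+ N = G@_m.

Definition Frobenius_nonclassical (K : closedFieldType) (N : nat)
    (G : {mpoly K[3]}) : Prop :=
  defined_over N G /\
  forall P : 'rV[K]_3, on_curve G P -> nonsingular_at G P ->
    on_tangent G P (map_mx (fun a => a ^+ N) P).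

(* Main.v *)
(* Let q = #|F| and let D be the derivation that sends each variable X_i to X_i^(q^3).
   It kills q-th powers, so it acts on a Moore determinant by replacing its
   first column with the q^3-th powers: D(D1) has two equal columns, hence
   vanishes, and D(D2) is up to a cyclic permutation of the columns D2^q.
   Applying D to DGZ * D2 = D1 gives D(DGZ) = - DGZ * D2^(q-1), which vanishes
   on the curve, and at a point P the value of D(DGZ) is the left-hand side of
   the tangent line equation at the image of P under the q^3-Frobenius map. *)

Require Import Defs.
From mathcomp Require Import all_boot all_fingroup all_algebra all_field.
From mathcomp Require Import mpoly.

Import GRing.Theory.

Local Open Scope ring_scope.

(** By the hypothesis on [N], raising to the power [N] is a ring endomorphism, so it commutes with
    determinants. *)
Lemma det_map_exp_pchar (R : comNzRingType) (N n : nat) (A : 'M[R]_n) :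
  [pchar R].-nat N -> \det (map_mx (fun a => a ^+ N) A) = (\det A) ^+ N.
Proof.
move=> pN; have N_gt0 : (0 < N)%N by case/andP: pN.
have expD : {morph (fun a : R => a ^+ N) : a b / a + b}.
  by move=> a b; apply: exprDn_pchar.
have exp0 : (0 : R) ^+ N = 0 by rewrite expr0n gtn_eqF.
rewrite /determinant (big_morph _ expD exp0); apply: eq_bigr => s _.
rewrite exprMn -prodrXl; congr (_ * _).
  by rewrite exprAC (exprNn_pchar 1 pN) expr1n.
by apply: eq_bigr => i _; rewrite mxE.
Qed.

Lemma moore_det_succ (R : comNzRingType) (q a b c : nat) (x : 'I_3 -> R) :
  [pchar R].-nat q ->
  moore_det q [:: a.+1; b.+1; c.+1] x = moore_det q [:: a; b; c] x ^+ q.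
Proof.
move=> pq; rewrite /moore_det -det_map_exp_pchar //; congr (\det _).
apply/matrixP => i j; rewrite !mxE -exprM -expnSr.
by case: j => -[|[|[|]]].
Qed.

(** A 3-cycle of the columns is a product of two transpositions, whose signs cancel. *)
Lemma moore_det_rot (R : comNzRingType) (q a b c : nat) (x : 'I_3 -> R) :
  moore_det q [:: c; a; b] x = moore_det q [:: a; b; c] x.
Proof.
rewrite /moore_det; set A := (X in _ = \det X).
have -> : \matrix_(i, j) x i ^+ (q ^ nth 0%N [:: c; a; b] j) =
          xcol 0 1 (xcol 1 ord_max A).
  apply/matrixP => i j; rewrite !mxE; congr (_ ^+ (_ ^ _)).
  by case: j => -[|[|[|]]] // ltj3; rewrite !permE /= ?permE /= -?val_eqE /=.
by rewrite !xcolE !det_mulmx !det_perm !odd_tperm -!mulrA -signr_addb mulr1.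
Qed.

(** These cofactors see only the last two columns, so [c] and [d] may differ. Written as [q]-th
    powers, they will be constants for the derivation. *)
Lemma cofactor_moore_succ (R : comNzRingType) (q a b c d : nat)
    (x : 'I_3 -> R) (i : 'I_3) :
  [pchar R].-nat q ->
  cofactor (\matrix_(i < 3, j < 3) x i ^+ (q ^ nth 0%N [:: c; a.+1; b.+1] j))
    i 0 =
  cofactor (\matrix_(i < 3, j < 3) x i ^+ (q ^ nth 0%N [:: d; a; b] j)) i 0
    ^+ q.
Proof.
move=> pq; rewrite /cofactor exprMn -det_map_exp_pchar // exprAC.
rewrite (exprNn_pchar 1 pq) expr1n; congr (_ * \det _).
apply/matrixP => k j; rewrite !mxE -exprM -expnSr.
by case: j => -[|[|]].
Qed.

Lemma mderiv_exp (n : nat) (R : comNzRingType) (i : 'I_n) (G : {mpoly R[n]})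
    (m : nat) : (G ^+ m)^`M(i) = G^`M(i) * G ^+ m.-1 *+ m.
Proof.
elim: m => [|m IH]; first by rewrite mulr0n expr0 -mpolyC1 mderivC.
rewrite exprS mderivM IH mulrnAr mulrCA mulrS.
by case: m {IH} => [|m]; rewrite ?mulr0n // -exprS.
Qed.

Lemma mderiv_exp_pchar (n : nat) (R : comNzRingType) (i : 'I_n)
    (G : {mpoly R[n]}) (m : nat) :
  [pchar {mpoly R[n]}].-nat m -> (1 < m)%N -> (G ^+ m)^`M(i) = 0.
Proof.
move=> pm m_gt1; rewrite mderiv_exp.
(* A prime factor of [m] is zero in the ring, hence so is the factor [m] from the power rule. *)
have p_pr := pdiv_prime m_gt1; have /dvdnP [k mE] := pdiv_dvd m.
have pA : pdiv m \in [pchar {mpoly R[n]}].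
  by apply: (pnatPpi pm); rewrite mem_primes p_pr pdiv_dvd ltnW.
by rewrite {2}mE -mulr_natr natrM (pcharf0 pA) !mulr0.
Qed.

Lemma mderiv_map_mpoly (n : nat) (R S : nzRingType) (f : {rmorphism R -> S})
    (i : 'I_n) (G : {mpoly R[n]}) :
  (map_mpoly f G)^`M(i) = map_mpoly f G^`M(i).
Proof.
by apply/mpolyP => m; rewrite !(mcoeff_map_mpoly, mcoeff_deriv) raddfMn.
Qed.

Definition Frobenius_derivative (R : comNzRingType) (N : nat)
    (G : {mpoly R[3]}) : {mpoly R[3]} :=
  \sum_(i < 3) G^`M(i) * 'X_i ^+ N.

Lemma Frobenius_derivativeM (R : comNzRingType) (N : nat) (G H : {mpoly R[3]}) :
  Frobenius_derivative R N (G * H) =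
  Frobenius_derivative R N G * H + G * Frobenius_derivative R N H.
Proof.
rewrite /Frobenius_derivative mulr_suml mulr_sumr -big_split /=.
by apply: eq_bigr => i _; rewrite mderivM mulrDl mulrAC mulrA.
Qed.

(* Only the first column of the determinant has a nonzero derivative. *)
Lemma Frobenius_derivative_moore_det (F : finFieldType) (k a b : nat) :
  let q := #|F| in
  Frobenius_derivative F (q ^ k) (moore_det q [:: 0; a.+1; b.+1]%N (vars F)) =
  moore_det q [:: k; a.+1; b.+1] (vars F).
Proof.
move=> q; have q_gt1 : (1 < q)%N by apply: finNzRing_gt1.
have pq : [pchar {mpoly F[3]}].-nat q by rewrite -[q]expn1 pchar_nat_card.
rewrite /moore_det !(expand_det_col _ 0) /Frobenius_derivative.
apply: eq_bigr => i _; rewrite raddf_sum (bigD1 i) //= big1 => [|j ji].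
  (* Taking [d := 0] brings the cofactors of both determinants to the same [q]-th power. *)
  rewrite !mxE !(cofactor_moore_succ _ _ _ _ _ 0) // addr0 mderivM /= expr1.
  rewrite mderiv_exp_pchar // mulr0 addr0 mderivX.
  by rewrite mnm1E eqxx scale1r -{1}[U_(i)%MM]add0m addmK mpolyX0 mul1r mulrC.
rewrite !mxE (cofactor_moore_succ _ _ _ _ _ 0) // mderivM /= expr1.
rewrite mderiv_exp_pchar // mulr0 addr0 mderivX.
by rewrite mnm1E (negPf ji) scale0r mul0r.
Qed.

Lemma Frobenius_derivative_DGZ (F : finFieldType) :
  let q := #|F| in
  Frobenius_derivative F (q ^ 3) (DGZ F) =
  - (DGZ F * D2 q (vars F) ^+ q.-1).
Proof.
move=> q; apply: (mulIf (D2_neq0 F)).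
have q_gt0 : (0 < q)%N by apply/card_gt0P; exists 0.
have pq : [pchar {mpoly F[3]}].-nat q by rewrite -[q]expn1 pchar_nat_card.
(* Multiplied by [D2], the claim says that the Leibniz expansion of the derivative of [DGZ F * D2],
   that is of [D1], is zero. *)
rewrite mulNr -mulrA -exprSr prednK //; apply/eqP; rewrite -addr_eq0; apply/eqP.
have D2q : Frobenius_derivative F (q ^ 3) (D2 q (vars F)) = D2 q (vars F) ^+ q.
  (* The exponents 3, 1, 2 rotate to 1, 2, 3, the shift of 0, 1, 2. *)
  rewrite Frobenius_derivative_moore_det moore_det_rot.
  exact: moore_det_succ.
rewrite -D2q -Frobenius_derivativeM DGZ_D2 Frobenius_derivative_moore_det.
(* The exponents are now 3, 1, 3; transposing turns the equal outer columns into equal rows. *)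
rewrite /moore_det -det_tr (@determinant_alternate _ _ _ 0 ord_max) //.
by move=> j; rewrite !mxE.
Qed.

Theorem proposition8p2 (p h q : nat) (F : finFieldType) (K : closedFieldType)
    (iota : {rmorphism F -> K}) :
  prime p -> q = (p ^ h)%N -> (3 <= q)%N -> #|F| = q ->
  integralRange iota ->
  Frobenius_nonclassical (q ^ 3) (map_mpoly iota (DGZ F)).
Proof.
move=> _ _ _ <- _; split=> [m | P /andP [_ /eqP GP] _].
  (* Coefficients come from [F], where the [q]-th power map is the identity. *)
  by rewrite mcoeff_map_mpoly -rmorphXn /= !expnSr expn0 mul1n !exprM !expf_card.
have dG : (map_mpoly iota (Frobenius_derivative F (#|F| ^ 3) (DGZ F))).@[P 0] = 0.
  by rewrite Frobenius_derivative_DGZ rmorphN rmorphM mevalN mevalM GP mul0r oppr0.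
apply/eqP; apply: etrans dG; rewrite /Frobenius_derivative.
rewrite (raddf_sum (map_mpoly iota)) (raddf_sum (meval (P 0))).
apply: eq_bigr => i _ /=; rewrite rmorphM rmorphXn /= map_mpolyX mevalM.
by rewrite rmorphXn /= mevalXU mderiv_map_mpoly mxE.
Qed.
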